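(* Let $\mathbf{X}=\{\mathbf{X}_n\}_{n\ge0}$ be a process in $\mathbb{R}^p$, $p\ge1$, with $E\|\mathbf{X}_n\|^2<\infty$ for all $n$, adapted to a filtration $\{\mathcal{F}_n\}_{n\ge0}$. (i) If (A5), (A7), (A8) hold, then $\lim_n\|\mathbf{X}_n\|$ exists and is finite a.e. (ii) If (A6), (A7), (A8) hold, then $\lim_n\|\mathbf{X}_n\|=0$ a.e.
   Context: $\|\cdot\|$ is the Euclidean norm. Residual vectors: $\boldsymbol{\epsilon}_n=\mathbf{X}_n-E[\mathbf{X}_n\mid\mathcal{F}_{n-1}]$, $n\ge1$, with components $\boldsymbol{\epsilon}_n(t)$, $t\in\{1,\dots,p\}$. (A5) There are constants $\alpha_n\ge0$ with $\sum_n\alpha_n<\infty$ such that a.e., for all $n\ge1$: $\frac{\|E[\mathbf{X}_n\mid\mathcal{F}_{n-1}]\|}{\|\mathbf{X}_{n-1}\|}I\{\|\mathbf{X}_{n-1}\|\ne0\}\le1+\alpha_n$. (A6) There are constants $0<k_n\le1$ with $\sum_n(1-k_n)=\infty$ such that a.e., for all $n\ge1$: $\frac{\|E[\mathbf{X}_n\mid\mathcal{F}_{n-1}]\|}{\|\mathbf{X}_{n-1}\|}I\{\|\mathbf{X}_{n-1}\|\ne0\}\le k_n$. (A7) $\lim_n E[\mathbf{X}_n\mid\mathcal{F}_{n-1}]\,I\{\mathbf{X}_{n-1}=\mathbf{0}\}=\mathbf{0}$ a.e. (A8) There are constants $v_n\ge0$ with $\sum_n v_n<\infty$ such that $\max_{1\le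 t\le p}\mathrm{Var}(\boldsymbol{\epsilon}_n(t)\mid\mathcal{F}_{n-1})\le v_n$ a.e. for all $n\ge1$. *)

(* Defs.v *)
From HB Require Import structures.
From mathcomp Require Import all_boot all_order all_algebra.
From mathcomp Require Import all_classical all_reals all_analysis.
Set Implicit Arguments. Unset Strict Implicit. Unset Printing Implicit Defensive.
Import Order.TTheory GRing.Theory Num.Theory.
Import numFieldNormedType.Exports.
Local Open Scope classical_set_scope.
Local Open Scope ring_scope.

Definition enorm {R : realType} {p : nat} (x : 'rV[R]_p) : R :=
  Num.sqrt (\sum_(t < p) x ord0 t ^+ 2).

Definition sub_sigma_algebra {d} {T : measurableType d} (G : set (set T)) :=
  sigma_algebra setT G /\ G `<=` measurable.

Definition G_measurable {d} {T : measurableType d} {R : realType}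
  (G : set (set T)) (f : T -> R) :=
  forall B : set R, measurable B -> G (f @^-1` B).

Definition filtration {d} {T : measurableType d} (F : nat -> set (set T)) :=
  (forall n, sub_sigma_algebra (F n)) /\ (forall n, F n `<=` F n.+1).

Definition cond_exp_version {d} {T : measurableType d} {R : realType}
  (P : probability T R) (G : set (set T)) (Y Z : T -> R) :=
  [/\ P.-integrable setT (EFin \o Y),
      G_measurable G Z,
      P.-integrable setT (EFin \o Z) &
      forall A, G A ->
        (\int[P]_(x in A) (Z x)%:E = \int[P]_(x in A) (Y x)%:E)%E].

(* Main.v *)
(** Write [e = X_(n+1) - M_n] for the residual, [u] for the unit vector along
    [M_n] and [delta = <u, e>].  Then
    [|X_(n+1)|^2 = |M_n|^2 + 2 |M_n| delta + |e|^2 <= (|M_n| + delta)^2 + |e|^2].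
    By (A8) the series of [|e|^2] converges a.e., and so does the martingale
    series of [delta]; the latter follows from Kolmogorov's maximal inequality, proved by
    freezing the partial sums once they leave a small interval.  The rest is
    pathwise.  For every [c > 0], once [n] is large, [|X_(n+1)| >= c] forces
    [|M_n|] to be bounded below, hence by (A7) [X_n <> 0], and then
    [|X_(n+1)| <= kappa_n |X_n| + r_n] for a convergent series [r], where
    [kappa_n] is [1 + alpha_(n+1)] or [k_(n+1)].  Such a sequence is almost nonincreasing above every level, hence converges; a
    positive limit would make the series of [1 - kappa_n] converge. *)

Require Import Defs.
From HB Require Import structures.
From mathcomp Require Import all_boot all_order all_algebra.
From mathcomp Require Import all_classical all_reals all_analysis.
From mathcomp Require Import measurable_realfun ring lra zify.
Import Order.TTheory GRing.Theory Num.Theory.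
Import numFieldNormedType.Exports.
Local Open Scope classical_set_scope.
Local Open Scope ring_scope.

(** * Almost nonincreasing sequences *)

Lemma cvgn_cauchy (R : realType) (u : nat -> R) : cvgn u ->
  forall e, 0 < e ->
  exists N, forall i j, (N <= i)%N -> (N <= j)%N -> `|u i - u j| <= e.
Proof.
move=> /cvg_ex[l ul] e e0.
have e2 : 0 < e / 2 by lra.
have /cvgrPdist_le/(_ _ e2)[N _ HN] := ul.
exists N => i j Ni Nj; have := HN _ Ni; have := HN _ Nj => /=.
rewrite !ler_norml; lra.
Qed.

Lemma cauchy_cvgn (R : realType) (u : nat -> R) :
  (forall e, 0 < e ->
    exists N, forall i, (N <= i)%N -> `|u i - u N| <= e) -> cvgn u.
Proof.
move=> H; apply/cauchy_cvgP/cauchy_ballP => e e0.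
have e2 : 0 < e / 3 by lra.
have [N HN] := H _ e2.
exists (u @` [set i | (N <= i)%N], u @` [set i | (N <= i)%N]).
  by split; exists N => // i /= Ni; exists i.
move=> [_ _] /= [[i /= Ni <-] [j /= Nj <-]].
rewrite /ball /=; have := HN _ Ni; have := HN _ Nj.
rewrite !ler_norml ltr_norml; lra.
Qed.

(* Between its last visit [i] below the level [c] and time [j], the sequence
   grows by at most the corresponding block of the series. *)
Lemma block_bound (R : realType) (y r : nat -> R) (c : R) (N J : nat) :
  (forall n, (N <= n)%N -> (n < J)%N -> c <= y n.+1 -> y n.+1 <= y n + r n) ->
  forall j, (N <= j)%N -> (j <= J)%N ->
  exists2 i, (N <= i <= j)%N &
    y j <= Num.max c (y N) + (series r j - series r i).
Proof.
move=> H; elim=> [|j IH].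
  rewrite leqn0 => /eqP -> _; exists 0%N => //.
  by rewrite subrr addr0 le_max lexx orbT.
rewrite leq_eqVlt => /orP[/eqP <- _|Nj jJ].
  by exists N; rewrite ?leqnn// subrr addr0 le_max lexx orbT.
have [cy|yc] := leP c (y j.+1); last first.
  exists j.+1; first by rewrite leqnn ltnW.
  by rewrite subrr addr0 le_max (ltW yc).
have [i /andP[Ni ij] Hi] := IH Nj (ltnW jJ).
exists i; first by rewrite Ni leqW.
rewrite seriesSr (le_trans (H j Nj jJ cy))//; lra.
Qed.

(** Boundedness comes first, since it turns [a n * y n] into a summable perturbation. After that,
    far enough out, no later value exceeds an earlier one by more than [e], and a nonnegative
    sequence with this property is Cauchy. *)
Lemma almost_nonincreasing_cvg (R : realType) (y a : nat -> R) :
  (forall n, 0 <= y n) -> (forall n, 0 <= a n) -> cvgn (series a) ->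
  (forall c, 0 < c -> exists2 r, cvgn (series r) &
    exists N, forall n, (N <= n)%N -> c <= y n.+1 ->
      y n.+1 <= (1 + a n) * y n + r n) ->
  cvgn y.
Proof.
move=> y0 a0 ca H.
have [K [K0 [N0 HK]]] : exists K, 0 <= K /\
    exists N0, forall n, (N0 <= n)%N -> y n <= K.
  have [r cr [N HN]] := H 1 ltr01.
  have h2 : 0 < 2^-1 :> R by lra.
  have [N1 HN1] := cvgn_cauchy _ _ ca _ h2.
  have [N2 HN2] := cvgn_cauchy _ _ cr _ ltr01.
  pose m := maxn N (maxn N1 N2).
  have mN : (N <= m)%N by rewrite leq_maxl.
  have mN1 : (N1 <= m)%N by rewrite /m; lia.
  have mN2 : (N2 <= m)%N by rewrite /m; lia.
  pose B := Num.max 1 (y m).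
  have B1 : 1 <= B by rewrite le_max lexx.
  (* Past [m] the blocks of [r] and [a] are at most [1] and [1/2], so [K] is chosen to solve
     [B + 1 + K / 2 = K]. *)
  pose K := 2 * (B + 1).
  exists K; split; first by rewrite /K; lra.
  exists m; elim/ltn_ind => j IH mj.
  (* The one-step bound is required only below [j], where the strong induction hypothesis already
     gives [y n <= K]. *)
  have [|i /andP[mi ij] Hi] := @block_bound R y (fun n => r n + K * a n) 1 m j _ j mj (leqnn _).
    move=> n mn nj yn; have := HN n (leq_trans mN mn) yn.
    have : a n * y n <= a n * K by rewrite ler_wpM2l// IH.
    by lra.
  have E k : series (fun n => r n + K * a n) k = series r k + K * series a k.
    by rewrite /series /= big_split /= mulr_sumr.
  move: Hi; rewrite -/B !E.
  have : `|series a j - series a i| <= 2^-1 by apply: HN1; lia.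
  have : `|series r j - series r i| <= 1 by apply: HN2; lia.
  rewrite !ler_norml => /andP[_ ?] /andP[_ ?].
  have : K * (series a j - series a i) <= K * 2^-1.
    by rewrite ler_wpM2l// /K; lra.
  rewrite /K; lra.
have K1 : 0 < K + 1 by lra.
have osc e : 0 < e -> exists N, forall n j, (N <= n)%N -> (n <= j)%N -> y j <= y n + e.
  move=> e0; have e2 : 0 < e / 2 by lra.
  have [r cr [N HN]] := H _ e2.
  pose r' n := r n + K * a n.
  have cr' : cvgn (series r').
    rewrite /r' (_ : series _ = series r + K *: series a).
      by apply: is_cvgD => //; apply: is_cvgZr.
    by apply/funext => k; rewrite /series /= big_split /= -mulr_sumr.
  have [N1 HN1] := cvgn_cauchy _ _ cr' _ e2.
  exists (maxn N0 (maxn N N1)) => n j nN nj.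
  have [n' nn' n'j yn'|i /andP[ni ij]] := @block_bound R y r' (e / 2) n j _ j nj (leqnn _).
    have Nn' : (N <= n')%N by lia.
    have := HN n' Nn' yn'; rewrite /r'.
    have : a n' * y n' <= a n' * K by rewrite ler_wpM2l// HK//; lia.
    lra.
  (* Since [y n >= 0], working above the level [e / 2] costs at most [e / 2]. *)
  have : Num.max (e / 2) (y n) <= y n + e / 2.
    by rewrite ge_max; have := y0 n; lra.
  have : `|series r' j - series r' i| <= e / 2 by apply: HN1; lia.
  rewrite ler_norml.
  lra.
apply: cauchy_cvgn => e e0.
have [N HN] := osc e e0.
pose S := [set y n | n in [set n | (N <= n)%N]].
have iS : has_inf S.
  split; first by exists (y N), N => /=.
  by exists 0 => _ [n _ <-].
(* Terms after [n0] lie above [inf S] and at most [e] above [y n0], which is itself within [e] of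
   [inf S]. *)
have [_ [n0 /= Nn0 <-] Hn0] := @inf_adherent R S e e0 iS.
exists n0 => i n0i.
have := HN n0 i Nn0 n0i.
have : inf S <= y i by apply: ge_inf; [exact: iS.2|exists i => //=; lia].
rewrite ler_norml; lra.
Qed.

(** As [k n <= 1], convergence is the case [a = 0] of the previous lemma. Near a positive limit, [y]
    stays above half of it, so each step loses at least [c * (1 - k n)] up to [r n]; telescoping
    bounds the partial sums of [1 - k]. *)
Lemma contraction_cvg0 (R : realType) (y k : nat -> R) :
  (forall n, 0 <= y n) -> (forall n, k n <= 1) ->
  ~ cvgn (series (fun n => 1 - k n)) ->
  (forall c, 0 < c -> exists2 r, cvgn (series r) &
    exists N, forall n, (N <= n)%N -> c <= y n.+1 ->
      y n.+1 <= k n * y n + r n) ->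
  y @ \oo --> 0.
Proof.
move=> y0 k1 ncv H.
have cy : cvgn y.
  apply: (@almost_nonincreasing_cvg R y (fun=> 0)) => //.
    rewrite (_ : series _ = fun=> 0); first exact: is_cvg_cst.
    by apply/funext => n; rewrite /series /= big1.
  move=> c /H[r cr [N HN]]; exists r => //; exists N => n Nn /(HN n Nn) h.
  by rewrite (le_trans h)// addr0 lerD2r ler_wpM2r.
have /cvg_ex[l yl] := cy.
have [l0|l0] := leP l 0.
  have l0' : 0 <= l.
    rewrite -(cvg_lim _ yl)//; apply: limr_ge => //; exact: nearW.
  by have <- : l = 0 by lra.
exfalso; apply: ncv.
pose c := l / 2; have c0 : 0 < c by rewrite /c; lra.
have [r cr [N HN]] := H _ c0.
have [N1 HN1] := cvgn_cauchy _ _ cr _ ltr01.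
have /cvgrPdist_le/(_ _ c0)[N2 _ HN2] := yl.
have yc n : (N2 <= n)%N -> c <= y n.
  by move=> /HN2 /=; rewrite ler_norml /c; lra.
pose m := maxn N (maxn N1 N2).
pose u n := 1 - k n.
have u0 n : 0 <= u n by rewrite /u; have := k1 n; lra.
(* The quantity [c * series u + y] can grow only by blocks of [r]. *)
have step j : c * series u (m + j)%N + y (m + j)%N <=
    c * series u m + y m + (series r (m + j)%N - series r m).
  elim: j => [|j IH]; first by rewrite addn0; lra.
  rewrite addnS !seriesSr.
  have A1 : y (m + j).+1 <= k (m + j)%N * y (m + j)%N + r (m + j)%N.
    by apply: HN; [rewrite /m; lia|apply: yc; rewrite /m; lia].
  have : u (m + j)%N * c <= u (m + j)%N * y (m + j)%N.
    by rewrite ler_wpM2l// yc// /m; lia.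
  rewrite /u in IH *; lra.
have nd : nondecreasing_seq (series u).
  by apply/nondecreasing_seqP => n; rewrite seriesSr lerDl; exact: u0.
apply: (nondecreasing_is_cvgn nd).
exists (c^-1 * (c * series u m + y m + 1)) => _ [n _ <-].
rewrite -ler_pdivrMl ?invr_gt0// invrK.
have A : c * series u n <= c * series u (m + n)%N.
  by rewrite ler_wpM2l ?(ltW c0)// nd// leq_addl.
have := step n.
have : `|series r (m + n)%N - series r m| <= 1 by apply: HN1; lia.
have := y0 (m + n)%N.
rewrite ler_norml -/u; lra.
Qed.

(** Once [m n + dl n >= c / 4], set [z = 2 / c * e n]: the cross term [2 * (m n + dl n) * z] in the
    square of [m n + dl n + z] is at least [e n]. The quadratic error thus becomes a linear one. *)
Lemma perturbed_norm_step (R : realType) (y m dl e k : nat -> R) :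
  (forall n, 0 <= y n) -> (forall n, 0 <= m n) -> (forall n, 0 <= e n) ->
  (forall n, y n.+1 ^+ 2 = m n ^+ 2 + 2 * m n * dl n + e n) ->
  cvgn (series dl) -> cvgn (series e) ->
  (forall n, y n != 0 -> m n <= k n * y n) ->
  (forall c, 0 < c -> exists N, forall n, (N <= n)%N -> y n = 0 -> m n < c) ->
  forall c, 0 < c -> exists2 r, cvgn (series r) &
    exists N, forall n, (N <= n)%N -> c <= y n.+1 ->
      y n.+1 <= k n * y n + r n.
Proof.
move=> y0 m0 e0 E cd ce mk H0 c c0.
exists (fun n => dl n + (2 / c) * e n).
  rewrite (_ : series _ = series dl + (2 / c) *: series e).
    by apply: is_cvgD => //; apply: is_cvgZr.
  by apply/funext => n; rewrite /series /= big_split /= -mulr_sumr.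
have c4 : 0 < c / 4 by lra.
have c42 : 0 < (c / 4) ^+ 2 by rewrite exprn_gt0.
have /cvgrPdist_le/(_ _ c4)[N1 _ HN1] := cvg_series_cvg_0 cd.
have /cvgrPdist_le/(_ _ c42)[N2 _ HN2] := cvg_series_cvg_0 ce.
have c2 : 0 < c / 2 by lra.
have [N3 HN3] := H0 _ c2.
exists (maxn N1 (maxn N2 N3)) => n nN cy.
have /HN1/= : (N1 <= n)%N by lia.
rewrite sub0r normrN ler_norml => /andP[d1 d2].
have /HN2/= : (N2 <= n)%N by lia.
rewrite sub0r normrN ler_norml => /andP[_ e2].
have y2 : c ^+ 2 <= y n.+1 ^+ 2 by rewrite ler_sqr ?nnegrE// ltW.
have mc : c / 2 <= m n.
  (* Otherwise [m n < c / 2], [dl n <= c / 4] and [e n <= c^2 / 16] would give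
     [y n.+1 ^+ 2 <= 9 c^2 / 16 < c^2]. *)
  have [//|mc] := leP (c / 2) (m n); exfalso.
  have B1 : m n ^+ 2 <= (c / 2) ^+ 2 by rewrite ler_sqr ?nnegrE//; lra.
  have B2 : m n * dl n <= c / 2 * (c / 4).
    apply: (@le_trans _ _ (m n * (c / 4))); first by rewrite ler_wpM2l.
    by rewrite ler_wpM2r//; lra.
  have : 0 < c ^+ 2 by rewrite exprn_gt0.
  move: y2; rewrite E; rewrite !expr2 in B1 e2 *; lra.
have yn0 : y n != 0.
  apply/eqP => yn0; have : m n < c / 2 by apply: HN3 => //; lia.
  lra.
have mk' := mk n yn0.
suff : y n.+1 <= m n + dl n + 2 / c * e n by lra.
set z := 2 / c * e n.
have z0 : 0 <= z by rewrite /z mulr_ge0// divr_ge0// ltW.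
rewrite -ler_sqr ?nnegrE//; last by lra.
rewrite E.
have : e n = c / 2 * z by rewrite /z; field; lra.
move=> ->.
have : c / 2 * z <= 2 * (m n + dl n) * z by rewrite ler_wpM2r//; lra.
have := sqr_ge0 z; have := sqr_ge0 (dl n).
rewrite !expr2; lra.
Qed.

(** * Measurability and orthogonality for a sub-sigma-algebra *)

Section SubSigmaAlgebra.
Context {d} {T : measurableType d} {R : realType}.
Implicit Types (G : set (set T)) (f g h : T -> R).

(** A sigma-algebra generates itself, so measurability for [G] is ordinary measurability on
    [g_sigma_algebraType G] and inherits its closure properties. *)
Lemma G_measurableP G f : sigma_algebra setT G ->
  G_measurable G f <-> measurable_fun setT (f : g_sigma_algebraType G -> R).
Proof.
move=> sG; split=> [mf _ B mB|mf B mB].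
  by rewrite setTI; apply: sub_gen_smallest; exact: mf.
have := mf measurableT B mB.
by rewrite setTI /measurable/= sigma_algebra_id.
Qed.

Lemma G_measurable_fun G f : G `<=` measurable -> G_measurable G f ->
  measurable_fun setT f.
Proof. by move=> sG mf _ B mB; rewrite setTI; apply/sG/mf. Qed.

Lemma G_measurable_sub G G' f : G `<=` G' -> G_measurable G f -> G_measurable G' f.
Proof. by move=> sG mf B mB; apply/sG/mf. Qed.

Lemma G_measurable_comp G f (phi : R -> R) :
  measurable_fun setT phi -> G_measurable G f -> G_measurable G (phi \o f).
Proof.
move=> mphi mf B mB; rewrite comp_preimage; apply: mf.
by rewrite -[_ @^-1` _]setTI; exact: mphi.
Qed.

Lemma G_measurable_indic G A : sigma_algebra setT G -> G A ->
  G_measurable G (\1_A : T -> R).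
Proof.
move=> sG GA; apply/G_measurableP => //.
apply: measurable_indic; rewrite /measurable/= sigma_algebra_id//.
Qed.

Lemma G_measurableD G f g : sigma_algebra setT G ->
  G_measurable G f -> G_measurable G g -> G_measurable G (fun w => f w + g w).
Proof.
move=> sG /(G_measurableP _ _ sG) mf /(G_measurableP _ _ sG) mg.
by apply/G_measurableP => //; exact: measurable_funD.
Qed.

Lemma G_measurableB G f g : sigma_algebra setT G ->
  G_measurable G f -> G_measurable G g -> G_measurable G (fun w => f w - g w).
Proof.
move=> sG /(G_measurableP _ _ sG) mf /(G_measurableP _ _ sG) mg.
by apply/G_measurableP => //; exact: measurable_funB.
Qed.

Lemma G_measurableM G f g : sigma_algebra setT G ->
  G_measurable G f -> G_measurable G g -> G_measurable G (fun w => f w * g w).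
Proof.
move=> sG /(G_measurableP _ _ sG) mf /(G_measurableP _ _ sG) mg.
by apply/G_measurableP => //; exact: measurable_funM.
Qed.

Lemma G_measurable_sum G p (f : 'I_p -> T -> R) : sigma_algebra setT G ->
  (forall t, G_measurable G (f t)) -> G_measurable G (fun w => \sum_t f t w).
Proof.
move=> sG mf; apply/G_measurableP => //; apply: measurable_sum => t.
exact/G_measurableP.
Qed.

End SubSigmaAlgebra.

Section Integrals.
Context {d} {T : measurableType d} {R : realType} (P : probability T R).
Implicit Types (f g h : T -> R).

Lemma integrable_mul_bounded f h C :
  measurable_fun setT h -> (forall w, `|h w| <= C) ->
  P.-integrable setT (EFin \o f) ->
  P.-integrable setT (EFin \o (fun w => h w * f w)).
Proof.
move=> mh hC iF.
have mf : measurable_fun setT f by apply/measurable_EFinP; case/integrableP: iF.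
apply: (@le_integrable _ _ _ _ _ measurableT _ (fun w => (C%:E * (f w)%:E)%E)).
- by apply/measurable_EFinP; exact: measurable_funM.
- move=> w _ /=; rewrite lee_fin !normrM ler_wpM2r//.
  by rewrite (le_trans (hC w))// ler_norm.
- exact: integrableZl.
Qed.

(* Peeling off the leading binary digit [\1_A] of [h] halves the integral:
   [2 \int h f = \int (2 h - \1_A) f], and [2 h - \1_A] is again [0,1]-valued. *)
Lemma integral_mul_unit_bound (G : set (set T)) f :
  Defs.sub_sigma_algebra G -> P.-integrable setT (EFin \o f) ->
  (forall A, G A -> (\int[P]_(w in A) (f w)%:E = 0)%E) ->
  forall n h, G_measurable G h -> (forall w, 0 <= h w <= 1) ->
  `|\int[P]_w (h w * f w)| * 2 ^+ n <= \int[P]_w `|f w|.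
Proof.
move=> [sG GM] iF f0; elim=> [|n IH] h mh h01.
  have hb w : `|h w| <= 1 by rewrite ger0_norm; case/andP: (h01 w).
  have ihf := integrable_mul_bounded _ _ _ (G_measurable_fun _ _ GM mh) hb iF.
  rewrite expr0 mulr1 (le_trans (le_normr_Rintegral _ ihf))//.
  apply: le_Rintegral => //.
  - exact: (integrable_norm ihf).
  - exact: (integrable_norm iF).
  - by move=> w _; rewrite normrM ler_piMl.
pose A := h @^-1` `[2^-1, +oo[.
have GA : G A by apply: mh.
have mA := GM _ GA.
pose h' w := 2 * h w - \1_A w.
have mh' : G_measurable G h'.
  apply: G_measurableB => //; last exact: G_measurable_indic.
  by apply: (G_measurable_comp _ _ (fun x => 2 * x)) => //; exact: measurable_funM.
have h'01 w : 0 <= h' w <= 1.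
  rewrite /h' indicE; have := h01 w.
  case: (boolP (w \in A)) => [|] /=; rewrite /A.
    by rewrite inE /= in_itv /= andbT; lra.
  by rewrite notin_setE /= in_itv /= andbT => /negP; rewrite -ltNge; lra.
have h'b w : `|h' w| <= 1 by rewrite ger0_norm; case/andP: (h'01 w).
have ih' := integrable_mul_bounded _ _ _ (G_measurable_fun _ _ GM mh') h'b iF.
have Ab w : `|\1_A w : R| <= 1 by rewrite ger0_norm // indicE; case: (_ \in _).
have iA := integrable_mul_bounded _ _ _ (measurable_indic mA) Ab iF.
have E : \int[P]_w (h w * f w) = 2^-1 * \int[P]_w (h' w * f w).
  transitivity (\int[P]_w (2^-1 * (h' w * f w + \1_A w * f w))).
    by apply: eq_Rintegral => w _; rewrite /h'; field.
  rewrite RintegralZl//; last exact: (integrableD measurableT ih' iA).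
  rewrite RintegralD//.
  suff -> : \int[P]_w (\1_A w * f w) = 0 by rewrite addr0.
  rewrite /Rintegral -[RHS]/(fine 0%E) -(f0 _ GA); congr fine.
  rewrite [RHS]integral_mkcond; apply: eq_integral => w _.
  by rewrite patchE indicE; case: (w \in A); rewrite ?mul1r ?mul0r.
rewrite E normrM exprS mulrACA gtr0_norm ?mulVf// ?mul1r; exact: IH.
Qed.

(** For a [[0,1]]-valued factor the preceding bound holds with every power of two, which forces the
    integral to vanish. A bounded [h] reduces to this case by an affine change of values. *)
Lemma integral_mul_eq0 (G : set (set T)) f h C :
  Defs.sub_sigma_algebra G -> P.-integrable setT (EFin \o f) ->
  (forall A, G A -> (\int[P]_(w in A) (f w)%:E = 0)%E) ->
  G_measurable G h -> (forall w, `|h w| <= C) ->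
  (\int[P]_w (h w * f w)%:E = 0)%E.
Proof.
move=> sG iF f0 mh hC.
have unit0 g : G_measurable G g -> (forall w, 0 <= g w <= 1) ->
    \int[P]_w (g w * f w) = 0.
  move=> mg g01; apply/eqP; rewrite -normr_eq0; apply/eqP/le_anti.
  rewrite normr_ge0 andbT leNgt; apply/negP => I0.
  set I := `|_| in I0.
  (* This exponent exceeds the ratio of the two integrals, hence so does the corresponding power of
     two. *)
  have := integral_mul_unit_bound _ _ sG iF f0 (Num.truncn ((\int[P]_w `|f w|) / I)).+1 _ mg g01.
  apply/negP; rewrite -ltNge -ltr_pdivrMl// mulrC.
  apply: (lt_trans (truncnS_gt _)).
  by rewrite -natrX ltr_nat ltn_expl.
have C0 : 0 <= C.
  rewrite leNgt; apply/negP => C0.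
  have [w _] : exists w : T, True by exists point.
  by have := hC w; have := normr_ge0 (h w); lra.
(* Adding [1] keeps the divisor positive even when [C = 0]; the factor is recovered as
   [h = 2 * K * g - K]. *)
pose K := C + 1; have K0 : 0 < K by rewrite /K; lra.
pose g w := (h w / K + 1) / 2.
have mg : G_measurable G g.
  apply: (G_measurable_comp _ _ (fun x => (x / K + 1) / 2)) => //.
  by apply: measurable_funM => //; apply: measurable_funD => //; apply: measurable_funM.
have g01 w : 0 <= g w <= 1.
  have : `|h w / K| <= 1.
    by rewrite normrM (gtr0_norm (x := K^-1)) ?invr_gt0// ler_pdivrMr// mul1r (le_trans (hC w))// /K; lra.
  by rewrite ler_norml /g; lra.
have gb w : `|g w| <= 1 by rewrite ger0_norm; case/andP: (g01 w).
have ig := integrable_mul_bounded _ _ _ (G_measurable_fun _ _ sG.2 mg) gb iF.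
have ih := integrable_mul_bounded _ _ _ (G_measurable_fun _ _ sG.2 mh) hC iF.
have f00 : \int[P]_w (f w) = 0.
  rewrite /Rintegral f0//; have [G0 GD _] := sG.1.
  by have := GD _ G0; rewrite setD0.
rewrite -[LHS]fineK; last exact: integrable_fin_num.
congr EFin; rewrite -/(Rintegral _ _ _).
transitivity (\int[P]_w (2 * K * (g w * f w) - K * f w)).
  by apply: eq_Rintegral => w _; rewrite /g; field; lra.
rewrite RintegralB//; [|exact: (integrableZl measurableT (2 * K) ig)|exact: (integrableZl measurableT K iF)].
by rewrite !RintegralZl// unit0// f00 !mulr0 subrr.
Qed.

End Integrals.

(** * Convergence of martingale series *)

Section MartingaleSeries.
Context {d} {T : measurableType d} {R : realType} (P : probability T R).
Context (F : nat -> set (set T)) (D : nat -> T -> R) (v : nat -> R).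
Context (hF : filtration F) (mD : forall n, G_measurable (F n.+1) (D n)).
Context (iD : forall n, P.-integrable setT (EFin \o D n)).
Context (D0 : forall n h C,
  G_measurable (F n) h -> (forall w, `|h w| <= C) ->
  (\int[P]_w (h w * D n w)%:E = 0)%E).
Context (iD2 : forall n, P.-integrable setT (EFin \o (fun w => D n w ^+ 2))).
Context (D2v : forall n, \int[P]_w (D n w ^+ 2) <= v n).

Let phi (lam x : R) : R := \1_(`]- lam, lam[ : set R) x.

Let phiE lam x : phi lam x = if `|x| < lam then 1 else 0.
Proof.
rewrite /phi indicE ltr_norml.
case: ifPn => h; last by rewrite memNset //= in_itv /=; exact/negP.
by rewrite mem_set //= in_itv.
Qed.

Let mphi lam : measurable_fun setT (phi lam).
Proof. exact: measurable_indic. Qed.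

Let phib lam x : `|phi lam x| <= 1.
Proof. by rewrite phiE; case: ifP; rewrite ?normr1 ?normr0. Qed.

(* Freezing the sum once it leaves ]-lam, lam[ keeps the factor multiplying [D]
   in the cross term of the square bounded. *)
Fixpoint stopped_sum (lam : R) (n j : nat) (w : T) : R :=
  if j is i.+1 then
    stopped_sum lam n i w + phi lam (stopped_sum lam n i w) * D (n + i)%N w
  else 0.

Let sF n : sigma_algebra setT (F n). Proof. by case: (hF.1 n). Qed.
Let FM n : F n `<=` measurable. Proof. by case: (hF.1 n). Qed.

Lemma stopped_sum_measurable lam n j :
  G_measurable (F (n + j)) (stopped_sum lam n j).
Proof.
elim: j => [|j IH] /=.
  by apply/G_measurableP => //; exact: measurable_cst.
have FS := hF.2 (n + j)%N; rewrite addnS.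
apply: G_measurableD => //; first exact: G_measurable_sub IH.
apply: G_measurableM => //.
by apply: (G_measurable_sub _ _ _ FS); exact: (G_measurable_comp _ _ (phi lam)).
Qed.

(** In the expanded square the cross term integrates to zero by [D0], its factor being bounded by
    [lam] and measurable for [F (n + j)]. The squared increment adds at most [v (n + j)]. *)
Lemma stopped_sum_sqr_le lam n j : 0 < lam ->
  P.-integrable setT (EFin \o (fun w => stopped_sum lam n j w ^+ 2)) /\
  \int[P]_w (stopped_sum lam n j w ^+ 2) <= series v (n + j)%N - series v n.
Proof.
move=> lam0; elim: j => [|j [IH1 IH2]] /=.
  rewrite addn0 subrr expr0n /=; split.
    exact: (finite_measure_integrable_cst P 0 measurableT).
  by rewrite Rintegral_cst// mul0r.
rewrite addnS seriesSr.
set q := stopped_sum lam n j in IH1 IH2 *.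
have mq : G_measurable (F (n + j)) q by exact: stopped_sum_measurable.
pose g w := phi lam (q w) * q w.
have mg : G_measurable (F (n + j)) g.
  apply: (G_measurable_comp _ _ (fun x => phi lam x * x)) => //.
  exact: measurable_funM.
have gb w : `|g w| <= lam.
  by rewrite /g phiE; case: ifP => h; rewrite ?mul1r ?mul0r ?normr0// ltW.
have ig := integrable_mul_bounded P _ _ _ (G_measurable_fun _ _ (@FM _) mg) gb (iD (n + j)%N).
have g0 := D0 _ _ _ mg gb.
have mp : G_measurable (F (n + j)) (fun w => phi lam (q w)).
  exact: (G_measurable_comp _ _ (phi lam)).
have ip := integrable_mul_bounded P _ _ _ (G_measurable_fun _ _ (@FM _) mp)
  (fun w => phib lam (q w)) (iD2 (n + j)%N).
(* [phi] takes only the values [0] and [1], hence equals its own square. *)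
have E w : (q w + phi lam (q w) * D (n + j)%N w) ^+ 2 =
    q w ^+ 2 + (2 * (g w * D (n + j)%N w) + phi lam (q w) * D (n + j)%N w ^+ 2).
  by rewrite /g phiE; case: ifP => _; ring.
have i2 := integrableZl measurableT 2 ig.
have i3 := integrableD measurableT i2 ip.
have i4 := integrableD measurableT IH1 i3.
under [in X in X /\ _]eq_fun do rewrite E.
under eq_Rintegral do rewrite E.
split; first exact: i4.
rewrite RintegralD// RintegralD// RintegralZl//.
rewrite {2}/Rintegral g0 mulr0 add0r.
suff : \int[P]_w (phi lam (q w) * D (n + j)%N w ^+ 2) <= v (n + j)%N by lra.
apply: le_trans (D2v _); apply: le_Rintegral => // w _.
by rewrite phiE; case: ifP; rewrite ?mul1r ?mul0r ?sqr_ge0.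
Qed.

Let exit lam n j := [set w | lam <= `|stopped_sum lam n j w|].

Let mexit lam n j : measurable (exit lam n j).
Proof.
have mq := G_measurable_fun _ _ (@FM _) (stopped_sum_measurable lam n j).
rewrite -[exit _ _ _]setTI; apply: measurable_fun_le => //; 
exact: measurableT_comp.
Qed.

(** Chebyshev's inequality bounds each exit event through the second moment. Freezing makes these
    events increase with [j], so the bound passes to their union by continuity from below. *)
Lemma stopped_sum_maximal lam n c : 0 < lam ->
  (forall j, series v (n + j)%N - series v n <= c * lam ^+ 2) ->
  (P (\bigcup_j exit lam n j) <= c%:E)%E.
Proof.
move=> lam0 hc.
have ub j : (P (exit lam n j) <= c%:E)%E.
  have [i1 i2] := stopped_sum_sqr_le _ n j lam0.
  have l2 : 0 < lam ^+ 2 by rewrite exprn_gt0.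
  rewrite -(@lee_pmul2l _ (lam ^+ 2)%:E)//.
  rewrite -integral_cst//.
  apply: (@le_trans _ _ (\int[P]_(w in exit lam n j) (stopped_sum lam n j w ^+ 2)%:E)%E).
    apply: ge0_le_integral => //.
    - by move=> w _; rewrite lee_fin ltW.
    - by apply: measurable_funTS; case/integrableP: i1.
    - move=> w /= h; rewrite lee_fin -(real_normK (num_real (stopped_sum _ _ _ _))).
      by rewrite ler_sqr ?nnegrE// ltW.
  apply: (@le_trans _ _ (\int[P]_w (stopped_sum lam n j w ^+ 2)%:E)%E).
    apply: ge0_subset_integral => //; first by case/integrableP: i1.
    by move=> w _; rewrite lee_fin sqr_ge0.
  rewrite -[leLHS]fineK; last exact: (integrable_fin_num measurableT i1).
  rewrite -EFinM lee_fin mulrC; exact: le_trans i2 (hc j).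
have cv : P (exit lam n j) @[j --> \oo] --> P (\bigcup_j exit lam n j).
  apply: nondecreasing_cvg_mu => //; first exact: bigcup_measurable.
  apply/nondecreasing_seqP => j; rewrite subsetEset => w /= h.
  by rewrite /exit /= phiE ltNge h /= mul0r addr0.
rewrite -(cvg_lim _ cv)//; apply: lime_le; first by apply/cvg_ex; eexists; exact: cv.
exact: nearW.
Qed.

Lemma martingale_series_cvg : cvgn (series v) ->
  {ae P, forall w, cvgn (series (D ^~ w))}.
Proof.
move=> cv.
pose lam m : R := m.+1%:R^-1.
have lam0 m : 0 < lam m by rewrite invr_gt0.
(* A sum started at [n] that never leaves the interval is never frozen, so it is the true block of
   the series. Since [lam m] tends to [0], this gives the Cauchy property. *)
suff : {ae P, forall w, forall m, exists n, forall j, `|stopped_sum (lam m) n j w| < lam m}.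
  apply: filterS => w H; apply: cauchy_cvgn => e e0.
  have [m me] : exists m, lam m < e.
    exists (Num.truncn e^-1); rewrite /lam invf_plt// ?posrE//.
    exact: truncnS_gt.
  have [n Hn] := H m.
  have E j : stopped_sum (lam m) n j w = series (D ^~ w) (n + j)%N - series (D ^~ w) n.
    elim: j => [|j IH]; first by rewrite addn0 subrr.
    rewrite /= phiE Hn mul1r IH addnS seriesSr; lra.
  exists n => i ni; have := Hn (i - n)%N; rewrite E subnKC// => h.
  by rewrite ltW// (lt_trans h).
apply: ae_foralln => m.
(* On this set exit occurs from every starting time. Its probability is at most any [e > 0]: choose
   [n] so that the blocks of [v] from [n] on are at most [e * lam m ^+ 2]. *)
exists (\bigcap_n \bigcup_j exit (lam m) n j); split.
- by apply: bigcap_measurable => // n _; exact: bigcup_measurable.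
- apply/eqP; rewrite eq_le measure_ge0 andbT.
  apply/lee_addgt0Pr => e e0; rewrite add0e.
  have e1 : 0 < e * lam m ^+ 2 by rewrite mulr_gt0// exprn_gt0.
  have [n Hn] := cvgn_cauchy _ _ cv _ e1.
  apply: (@le_trans _ _ (P (\bigcup_j exit (lam m) n j))).
    apply: le_measure; rewrite ?inE.
    - by apply: bigcap_measurable => // k _; exact: bigcup_measurable.
    - exact: bigcup_measurable.
    - by move=> w /(_ n I).
  apply: stopped_sum_maximal => // j.
  by apply: le_trans (ler_norm _) (Hn _ _ _ _) => //; rewrite leq_addr.
- move=> w /= H n _; apply: contrapT => H'; apply: H; exists n => j.
  by rewrite ltNge; apply/negP => h; apply: H'; exists j.
Qed.

End MartingaleSeries.

(** * Nonnegative series indexed from one *)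

Section NonnegSeries.
Context {R : realType}.
Implicit Types u : nat -> R.

Let partial_sumE u n :
  (\sum_(1 <= k < n.+1) (u k)%:E)%E = (series (fun n => u n.+1) n)%:E.
Proof. by rewrite big_add1 /= sumEFin. Qed.

(** Bridges two conventions: extended sums starting at index [1] in the hypotheses, real series
    starting at index [0] in the proof. *)
Lemma nneseries1_ltyP u : (forall n, (0 < n)%N -> 0 <= u n) ->
  (\sum_(1 <= n <oo) (u n)%:E < +oo)%E <-> cvgn (series (fun n => u n.+1)).
Proof.
move=> u0; have u0' n : (1 <= n)%N -> true -> (0 <= (u n)%:E)%E.
  by move=> n0 _; rewrite lee_fin u0.
split=> [ltoo|cu].
  have fin : (\sum_(1 <= n <oo) (u n)%:E)%E \is a fin_num.
    by rewrite ge0_fin_numE// nneseries_ge0.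
  apply: nondecreasing_is_cvgn.
    by apply/nondecreasing_seqP => n; rewrite seriesSr lerDl u0.
  exists (fine (\sum_(1 <= n <oo) (u n)%:E)%E) => _ [n _ <-].
  by rewrite -lee_fin fineK// -partial_sumE; exact: nneseries_lim_ge.
suff -> : (\sum_(1 <= n <oo) (u n)%:E)%E = (limn (series (fun n => u n.+1)))%:E.
  exact: ltry.
apply/cvg_lim => //; rewrite -cvg_shiftS /=.
under eq_fun do rewrite partial_sumE.
by apply/fine_cvgP; split; [exact: nearW|exact: cu].
Qed.

End NonnegSeries.

(** * Almost everywhere summability and conditional moments *)

Section ConditionalMoments.
Context {d} {T : measurableType d} {R : realType} (P : probability T R).

(** Termwise integration bounds the integral of the whole sum by the sum of [v], and an integrable
    function is finite a.e. *)
Lemma ae_series_cvg (f : nat -> T -> R) (v : nat -> R) :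
  (forall n w, 0 <= f n w) -> (forall n, P.-integrable setT (EFin \o f n)) ->
  (forall n, \int[P]_w (f n w) <= v n) -> cvgn (series v) ->
  {ae P, forall w, cvgn (series (f ^~ w))}.
Proof.
move=> f0 fi fv cv.
have mf n : measurable_fun setT (EFin \o f n) by case/integrableP: (fi n).
have Ef n : (\int[P]_w (f n w)%:E = (\int[P]_w f n w)%:E)%E.
  by rewrite fineK//; exact: integrable_fin_num (fi n).
have If0 n : 0 <= \int[P]_w f n w by apply: Rintegral_ge0.
have Fi : P.-integrable setT (fun w => \sum_(0 <= n <oo) (f n w)%:E)%E.
  apply/integrableP; split.
    by apply: ge0_emeasurable_sum => n; [move=> w _ _; rewrite lee_fin|move=> _; exact: mf].
  rewrite (eq_integral (fun w => \sum_(0 <= n <oo) (f n w)%:E)%E); last first.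
    by move=> w _; rewrite gee0_abs// nneseries_ge0// => n _ _; rewrite lee_fin.
  rewrite integral_nneseries//; last by move=> n w _; rewrite lee_fin.
  under eq_eseriesr do rewrite Ef.
  apply: (@le_lt_trans _ _ (limn (series v))%:E); last exact: ltry.
  apply: lime_le; first by apply: is_cvg_nneseries => n _ _; rewrite lee_fin.
  apply: nearW => n; rewrite sumEFin lee_fin.
  apply: (@le_trans _ _ (series v n)); first exact: ler_sum.
  apply: nondecreasing_cvgn_le => //.
  by apply/nondecreasing_seqP => k; rewrite seriesSr lerDl (le_trans (If0 k)).
have := integrable_ae measurableT Fi; apply: filterS => w /(_ I) fin.
apply: nnseries_is_cvg => //; by rewrite ltey_eq fin.
Qed.

(* Integrating against the sign of [W] gives [\int |W| = 0]. *)
Lemma ae_eq0_of_integral_eq0 (G : set (set T)) (W : T -> R) :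
  Defs.sub_sigma_algebra G -> G_measurable G W ->
  P.-integrable setT (EFin \o W) ->
  (forall A, G A -> (\int[P]_(w in A) (W w)%:E = 0)%E) ->
  {ae P, forall w, W w = 0}.
Proof.
move=> sG mW iW W0.
(* The sign function, written with indicators to make its measurability immediate. *)
pose s (x : R) : R := \1_(`]0, +oo[ : set R) x - \1_(`]-oo, 0[ : set R) x.
have sE x : s x = if 0 < x then 1 else if x < 0 then -1 else 0.
  rewrite /s !indicE !mem_setE !in_itv /= andbT.
  by case: ltgtP => _ /=; rewrite ?subrr ?subr0 ?sub0r.
have ms : measurable_fun setT s by apply: measurable_funB; exact: measurable_indic.
have := integral_mul_eq0 P _ _ _ 1 sG iW W0 (G_measurable_comp _ _ s ms mW).
have sb w : `|s (W w)| <= 1.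
  rewrite sE; case: ifP => _; first by rewrite normr1.
  by case: ifP => _; rewrite ?normrN1 ?normr0.
move=> /(_ sb) I0.
have [mW' _] := integrableP _ _ _ iW.
have /(ae_eq_integral_abs _ measurableT mW') : (\int[P]_w `|(EFin \o W) w| = 0)%E.
  rewrite -I0; apply: eq_integral => w _ /=; congr EFin; rewrite sE.
  case: (ltgtP (W w) 0) => [h|h|->].
  - by rewrite mulN1r ltr0_norm.
  - by rewrite mul1r gtr0_norm.
  - by rewrite mul0r normr0.
by apply: filterS => w /(_ I) [].
Qed.

(** As [f] integrates to zero over the sets of [G], [W] vanishes a.e., so [f - W] and [f] have the
    same second moment. That moment is the integral of [V] over the whole space. *)
Lemma integral_sqr_le_condvar (G : set (set T)) (f W V : T -> R) (v : R) :
  Defs.sub_sigma_algebra G ->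
  (forall A, G A -> (\int[P]_(w in A) (f w)%:E = 0)%E) ->
  cond_exp_version P G f W ->
  cond_exp_version P G (fun w => (f w - W w) ^+ 2) V ->
  0 <= v -> {ae P, forall w, V w <= v} ->
  P.-integrable setT (EFin \o (fun w => f w ^+ 2)) /\
  \int[P]_w (f w ^+ 2) <= v.
Proof.
move=> sG f0 [iF mW iW EW] [iG mV iV EV] v0 Vv.
have W0 : {ae P, forall w, W w = 0}.
  by apply: (ae_eq0_of_integral_eq0 G) => // A GA; rewrite EW// f0.
have mf : measurable_fun setT f by apply/measurable_EFinP; case/integrableP: iF.
have mf2 : measurable_fun setT (fun w => (f w ^+ 2)%:E).
  by apply/measurable_EFinP; exact: measurable_funX.
have [mG Glt] := integrableP _ _ _ iG.
have aeE : ae_eq P setT (fun w => (f w ^+ 2)%:E) (fun w => ((f w - W w) ^+ 2)%:E).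
  by apply: filterS W0 => w W0 _; rewrite W0 subr0.
have I2 : (\int[P]_w (f w ^+ 2)%:E = \int[P]_w ((f w - W w) ^+ 2)%:E)%E.
  exact: ae_eq_integral.
have i2 : P.-integrable setT (EFin \o (fun w => f w ^+ 2)).
  apply/integrableP; split => //.
  rewrite (eq_integral (fun w => (f w ^+ 2)%:E)); last first.
    by move=> w _; rewrite gee0_abs// lee_fin sqr_ge0.
  rewrite I2; apply: le_lt_trans Glt; rewrite le_eqVlt; apply/orP; left.
  apply/eqP/eq_integral => w _; by rewrite gee0_abs// lee_fin sqr_ge0.
split => //.
have GT : G setT by have [G0 GD _] := sG.1; have := GD _ G0; rewrite setD0.
have Vp := integrable_funepos measurableT iV.
rewrite -lee_fin fineK; last exact: (integrable_fin_num measurableT i2).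
rewrite I2 -(EV _ GT).
(* The bound on [V] is one-sided; its positive part allows the monotonicity of nonnegative
   integrals. *)
apply: (@le_trans _ _ (\int[P]_w (EFin \o V)^\+ w)%E).
  by apply: le_integral => // w _; rewrite funeposE le_max lexx.
apply: (@le_trans _ _ (\int[P]_w v%:E)%E); last first.
  rewrite (integral_cst P measurableT).
  by rewrite [X in (_ * X)%E](probability_setT P) mule1.
apply: ae_ge0_le_integral => //.
  by case/integrableP: Vp.
by apply: filterS Vv => w Vv _; rewrite funeposE ge_max !lee_fin Vv.
Qed.

End ConditionalMoments.

(** * The Euclidean norm *)

Section EuclideanNorm.
Context {R : realType} {p : nat}.
Implicit Types x e : 'rV[R]_p.

Lemma enorm_ge0 x : 0 <= enorm x.
Proof. exact: sqrtr_ge0. Qed.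

Lemma enorm_sqr x : enorm x ^+ 2 = \sum_(t < p) x ord0 t ^+ 2.
Proof. by rewrite sqr_sqrtr// sumr_ge0// => t _; exact: sqr_ge0. Qed.

Lemma ler_coord_enorm x t : `|x ord0 t| <= enorm x.
Proof.
rewrite -ler_sqr ?nnegrE ?enorm_ge0// real_normK ?num_real// enorm_sqr.
by rewrite (bigD1 t)//= lerDl sumr_ge0// => s _; exact: sqr_ge0.
Qed.

Lemma enorm_eq0 x : enorm x = 0 -> x = 0.
Proof.
move=> x0; apply/rowP => t; rewrite mxE.
by apply/eqP; rewrite -normr_le0 -x0 ler_coord_enorm.
Qed.

Lemma enorm_cvg0 (x : nat -> 'rV[R]_p) :
  x @ \oo --> (0 : 'rV[R]_p) -> (fun n => enorm (x n)) @ \oo --> 0.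
Proof.
move=> x0; rewrite [X in _ --> X](_ : 0 = Num.sqrt (\sum_(t < p) 0 : R)).
  apply: (@cvg_comp _ _ _ (fun n => \sum_(t < p) x n ord0 t ^+ 2) Num.sqrt
    \oo (nbhs (\sum_(t < p) 0 : R))); last exact: sqrt_continuous.
  apply: (cvg_big (@add_continuous _)) => t _.
  have z : 0 = 0 * 0 :> R by rewrite mulr0.
  rewrite [X in _ --> X]z.
  have xt : x n ord0 t @[n --> \oo] --> (0 : 'rV[R]_p) ord0 t.
    apply: (@cvg_comp _ _ _ x (fun A : 'rV[R]_p => A ord0 t) \oo
      (nbhs (0 : 'rV[R]_p)) _ x0).
    exact: coord_continuous.
  by rewrite mxE in xt; exact: (cvgM xt xt).
by rewrite big1 // sqrtr0.
Qed.

(** The unit vector along [x], or zero when [x = 0] because of the first factor. The real power of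
    the sum of squares makes it measurable in the coordinates by composition. *)
Definition direction x t : R := x ord0 t * (\sum_(s < p) x ord0 s ^+ 2) `^ (- 2^-1).

Lemma enorm_direction x t : enorm x * direction x t = x ord0 t.
Proof.
rewrite /direction /enorm; set S := \sum_(s < p) _.
have S0 : 0 <= S by rewrite sumr_ge0// => s _; exact: sqr_ge0.
have [S00|S00] := eqVneq S 0.
  have /enorm_eq0 -> : enorm x = 0 by rewrite /enorm -/S S00 sqrtr0.
  by rewrite mxE mul0r mulr0.
rewrite -powR12_sqrt// mulrCA -powRD; last by rewrite S00 implybT.
by rewrite subrr powRr0 mulr1.
Qed.

Lemma normr_direction x t : `|direction x t| <= 1.
Proof.
have [x0|x0] := eqVneq (enorm x) 0.
  by rewrite /direction (enorm_eq0 _ x0) mxE mul0r normr0.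
have {}x0 : 0 < enorm x by rewrite lt_neqAle eq_sym x0 enorm_ge0.
rewrite -(ler_pM2l x0) mulr1 -{1}(gtr0_norm x0) -normrM enorm_direction.
exact: ler_coord_enorm.
Qed.

Lemma enormD_sqr x e : enorm (x + e) ^+ 2 =
  enorm x ^+ 2 + 2 * enorm x * (\sum_(t < p) direction x t * e ord0 t)
    + \sum_(t < p) e ord0 t ^+ 2.
Proof.
rewrite !enorm_sqr mulr_sumr -!big_split /=; apply: eq_bigr => t _.
by rewrite mxE -(enorm_direction x t); ring.
Qed.

End EuclideanNorm.

(** * Convergence of the norms of the process *)

Lemma cvgn_series_sum (R : realType) (p : nat) (f : 'I_p -> nat -> R) :
  (forall t, cvgn (series (f t))) -> cvgn (series (fun n => \sum_(t < p) f t n)).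
Proof.
move=> cf; rewrite (_ : series _ = fun n => \sum_(t < p) series (f t) n).
  apply/cvg_ex; exists (\sum_(t < p) limn (series (f t))).
  exact: (cvg_big (@add_continuous _)).
by apply/funext => n; rewrite /series /= exchange_big.
Qed.

Theorem theorem6 (d : measure_display) (T : measurableType d) (R : realType)
  (P : probability T R) (p : nat) (F : nat -> set (set T))
  (X : nat -> T -> 'rV[R]_p)
  (M : nat -> T -> 'rV[R]_p)
  (W : nat -> 'I_p -> T -> R) (V : nat -> 'I_p -> T -> R)
  (alpha k v : nat -> R) :
  (0 < p)%N ->
  filtration F ->
  (* adapted, square integrable *)
  (forall n (t : 'I_p), G_measurable (F n) (fun w => X n w ord0 t)) ->
  (forall n, P.-integrable setT (fun w => ((enorm (X n w)) ^+ 2)%:E)) ->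
  (* M n = E[X_{n+1} | F_n] componentwise *)
  (forall n (t : 'I_p),
     cond_exp_version P (F n) (fun w => X n.+1 w ord0 t) (fun w => M n w ord0 t)) ->
  (* residual eps_{n+1} = X_{n+1} - E[X_{n+1} | F_n];
     W n t = E[eps_{n+1}(t) | F_n],
     V n t = Var(eps_{n+1}(t) | F_n) = E[(eps_{n+1}(t) - W n t)^2 | F_n] *)
  (forall n (t : 'I_p),
     cond_exp_version P (F n) (fun w => X n.+1 w ord0 t - M n w ord0 t) (W n t)) ->
  (forall n (t : 'I_p),
     cond_exp_version P (F n)
       (fun w => (X n.+1 w ord0 t - M n w ord0 t - W n t w) ^+ 2) (V n t)) ->
  (* (A7) *)
  {ae P, forall w,
     (fun n => if X n w == 0 then M n w else 0) @ \oo --> (0 : 'rV[R]_p)} ->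
  (* (A8) *)
  (forall n, (0 < n)%N -> 0 <= v n) ->
  (\sum_(1 <= n <oo) (v n)%:E < +oo)%E ->
  {ae P, forall w, forall n (t : 'I_p), V n t w <= v n.+1} ->
  (* (i): (A5) *)
  ((forall n, (0 < n)%N -> 0 <= alpha n) ->
   (\sum_(1 <= n <oo) (alpha n)%:E < +oo)%E ->
   {ae P, forall w, forall n,
      (if enorm (X n w) != 0 then enorm (M n w) / enorm (X n w) else 0)
        <= 1 + alpha n.+1} ->
   {ae P, forall w, cvgn (fun n => enorm (X n w))})
  /\
  (* (ii): (A6) *)
  ((forall n, (0 < n)%N -> 0 < k n <= 1) ->
   (\sum_(1 <= n <oo) (1 - k n)%:E = +oo)%E ->
   {ae P, forall w, forall n,
      (if enorm (X n w) != 0 then enorm (M n w) / enorm (X n w) else 0)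
        <= k n.+1} ->
   {ae P, forall w, (fun n => enorm (X n w)) @ \oo --> 0}).
Proof.
move=> p0 hF mX iX hM hW hV A7 v0 vlty A8.
have sF n : Defs.sub_sigma_algebra (F n) by exact: hF.1.
(* Indices are shifted: [eps n] is the residual at time [n + 1], measurable for [F n.+1] and
   orthogonal to [F n]. *)
pose eps n t w := X n.+1 w ord0 t - M n w ord0 t.
pose u n t w := direction (M n w) t.
have cv : cvgn (series (fun n => v n.+1)) by apply/nneseries1_ltyP.
have meps n t : G_measurable (F n.+1) (eps n t).
  apply: G_measurableB; [exact: (sF _).1|exact: mX|].
  apply: G_measurable_sub (hF.2 n) _; by case: (hM n t).
have ieps n t : P.-integrable setT (EFin \o eps n t) by case: (hW n t).
have eps0 n t A : F n A -> (\int[P]_(w in A) (eps n t w)%:E = 0)%E.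
  move=> FA; have mA : measurable A by apply: (sF n).2.
  have [iX1 _ iM EM] := hM n t.
  have iX1A := integrableS measurableT mA (@subsetT _ A) iX1.
  have iMA := integrableS measurableT mA (@subsetT _ A) iM.
  have -> : (\int[P]_(w in A) (eps n t w)%:E = \int[P]_(w in A) ((X n.+1 w ord0 t)%:E - (M n w ord0 t)%:E))%E.
    by apply: eq_integral => w _; rewrite EFinB.
  rewrite (integralB mA iX1A iMA) EM// subee//.
  exact: integrable_fin_num iX1A.
have eps2 n t : P.-integrable setT (EFin \o (fun w => eps n t w ^+ 2)) /\
    \int[P]_w (eps n t w ^+ 2) <= v n.+1.
  apply: (integral_sqr_le_condvar P (F n) _ (W n t) (V n t)) => //.
  - exact: eps0.
  - exact: hW.
  - exact: hV.
  - exact: v0.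
  - by apply: filterS A8 => w; exact.
have mu n t : G_measurable (F n) (u n t).
  have mM s : G_measurable (F n) (fun w => M n w ord0 s) by case: (hM n s).
  apply: G_measurableM; [exact: (sF n).1|exact: mM|].
  apply: (G_measurable_comp _ _ (fun x => x `^ (- 2^-1))).
    exact: measurable_powR.
  apply: (G_measurable_sum _ _ (fun s w => M n w ord0 s ^+ 2)); first exact: (sF n).1.
  by move=> s; apply: (G_measurable_comp _ _ (fun x => x ^+ 2)).
have ub n t w : `|u n t w| <= 1 by exact: normr_direction.
have mu' n t := G_measurable_fun _ _ (sF n).2 (mu n t).
(* The multiplier [u n t] is bounded by [1] and measurable for [F n], so the products are again
   martingale differences with second moments at most [v n.+1]. *)
have cvg_delta t : {ae P, forall w, cvgn (series (fun n => u n t w * eps n t w))}.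
  apply: (martingale_series_cvg P F (fun n w => u n t w * eps n t w) (fun n => v n.+1)) => //.
  - move=> n; apply: G_measurableM => //; first exact: (sF n.+1).1.
    exact: G_measurable_sub (hF.2 n) (mu n t).
  - by move=> n; apply: (integrable_mul_bounded P _ _ 1).
  - move=> n h C mh hC; under eq_integral do rewrite mulrA.
    apply: (integral_mul_eq0 P (F n) _ _ C) => //; first exact: eps0.
      by apply: G_measurableM => //; exact: (sF n).1.
    by move=> w; rewrite normrM (le_trans _ (hC w))// ler_piMr.
  - move=> n; have [i2 _] := eps2 n t.
    rewrite (_ : (fun w => _) = (fun w => u n t w ^+ 2 * eps n t w ^+ 2)); last first.
      by apply/funext => w; rewrite exprMn.
    apply: (integrable_mul_bounded P _ _ 1) => //; first exact: measurable_funX.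
    by move=> w; rewrite normrX exprn_ile1.
  - move=> n; have [i2 le2] := eps2 n t.
    have iu2 := integrable_mul_bounded P _ _ 1 (measurable_funX 2 (mu' n t)).
    apply: le_trans le2; apply: le_Rintegral => //.
    + rewrite (_ : (fun w => _) = (fun w => u n t w ^+ 2 * eps n t w ^+ 2)); last first.
        by apply/funext => w; rewrite exprMn.
      by apply: iu2 => // w; rewrite normrX exprn_ile1.
    + move=> w _; rewrite exprMn ler_piMl ?sqr_ge0//.
      by rewrite -real_normK ?num_real// exprn_ile1.
have cvg_sqr t : {ae P, forall w, cvgn (series (fun n => eps n t w ^+ 2))}.
  apply: (ae_series_cvg P (fun n w => eps n t w ^+ 2) (fun n => v n.+1)) => //.
  - by move=> n w; exact: sqr_ge0.
  - by move=> n; case: (eps2 n t).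
  - by move=> n; case: (eps2 n t).
have step (kap : nat -> R) :
    {ae P, forall w, forall n,
      (if enorm (X n w) != 0 then enorm (M n w) / enorm (X n w) else 0) <= kap n.+1} ->
    {ae P, forall w, forall c, 0 < c -> exists2 r, cvgn (series r) &
      exists N, forall n, (N <= n)%N -> c <= enorm (X n.+1 w) ->
        enorm (X n.+1 w) <= kap n.+1 * enorm (X n w) + r n}.
  have aes : {ae P, forall w, forall t, cvgn (series (fun n => eps n t w ^+ 2))}.
    exact: filter_forall.
  have aed : {ae P, forall w, forall t, cvgn (series (fun n => u n t w * eps n t w))}.
    exact: filter_forall.
  move=> hk; apply: filterS2 (filterI hk A7) (filterI aes aed) => w [] {}hk A7w [cs cd].
  apply: (perturbed_norm_step _ (fun n => enorm (X n w)) (fun n => enorm (M n w))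
    (fun n => \sum_(t < p) u n t w * eps n t w) (fun n => \sum_(t < p) eps n t w ^+ 2)).
  - by move=> n; exact: enorm_ge0.
  - by move=> n; exact: enorm_ge0.
  - by move=> n; apply: sumr_ge0 => t _; exact: sqr_ge0.
  - move=> n; have {1}-> : X n.+1 w = M n w + (X n.+1 w - M n w) by rewrite addrC subrK.
    rewrite enormD_sqr; congr (_ + _ * _ + _);
      by apply: eq_bigr => t _; rewrite !mxE.
  - exact: cvgn_series_sum.
  - exact: cvgn_series_sum.
  - move=> n Xn0; have := hk n; rewrite Xn0 ler_pdivrMr//.
    by rewrite lt_neqAle eq_sym Xn0 enorm_ge0.
  (* At times where [X n w = 0] the sequence in (A7) is [M n w] itself, so its norm is eventually
     below [c]. *)
  - move=> c c0; have /cvgrPdist_lt/(_ _ c0)[N _ HN] := enorm_cvg0 _ A7w.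
    exists N => n Nn /enorm_eq0 Xn0; have := HN n Nn.
    by rewrite /= Xn0 eqxx sub0r normrN ger0_norm// enorm_ge0.
split=> [a0 alty /(step (fun n => 1 + alpha n))|k01 kdiv /(step k)].
  apply: filterS => w H.
  apply: (almost_nonincreasing_cvg _ _ (fun n => alpha n.+1)) => //.
  - by move=> n; exact: enorm_ge0.
  - by move=> n; exact: a0.
  - by apply/nneseries1_ltyP.
apply: filterS => w H.
apply: (contraction_cvg0 _ _ (fun n => k n.+1)) => //.
- by move=> n; exact: enorm_ge0.
- by move=> n; case/andP: (k01 n.+1 isT).
- have k0 n : (0 < n)%N -> 0 <= 1 - k n.
    by move=> n0; rewrite subr_ge0; case/andP: (k01 n n0).
  by move=> /(nneseries1_ltyP _ k0); rewrite kdiv ltxx.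
Qed.
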